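(* There is no algorithm that, given two finite labeled Petri nets $N_1=(P_1,T_1,\mathrm{Pre}_1,\mathrm{Post}_1)$ and $N_2=(P_2,T_2,\mathrm{Pre}_2,\mathrm{Post}_2)$, markings $m_1\in\mathbb N^{P_1}$ and $m_2\in\mathbb N^{P_2}$, and a Presburger formula $E$ whose free variables are included in $P_1\cup P_2$, decides whether $(N_1,m_1)\equiv_E(N_2,m_2)$ holds. That is, the problem of checking whether a statement $(N_1,m_1)\equiv_E(N_2,m_2)$ is valid is undecidable.
   Context: A labeled Petri net $N=(P,T,\mathrm{Pre},\mathrm{Post})$ consists of a finite set of places $P$, a finite set of transitions $T$ disjoint from $P$, functions $\mathrm{Pre},\mathrm{Post}:T\to(P\to\mathbb N)$, and a labeling $l:T\to\Sigma\cup\{\tau\}$, where $\Sigma$ is an alphabet and $\tau\notin\Sigma$ is the silent action. A marking is a map $m:P\to\mathbb N$. Transition $t$ is enabled at $m$ if $m(p)\ge\mathrm{Pre}(t,p)$ for all $p\in P$, and then $m\xrightarrow{t}m'$ with $m'=m-\mathrm{Pre}(t)+\mathrm{Post}(t)$. For $\varrho=t_1\cdots t_n\in T^*$, $m\xRightarrow{\varrho}m'$ means there are markings $m=m_0,\dots,m_n=m'$ with $m_i\xrightarrow{t_{i+1}}m_{i+1}$. The labeling extends to sequences by erasing silent transitions: $l(\epsilon)=\epsilon$, $l(\varrho t)=l(\varrho)$ if $l(t)=\tau$, $l(\varrho t)=l(\varrho)l(t)$ otherwise. For $\sigma\in\Sigma^*$, $(N,m)\xRightarrow{\sigma}(N,m')$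 means that there is $\varrho\in T^*$ with $m\xRightarrow{\varrho}m'$ and $l(\varrho)=\sigma$; $\sigma$ is then an observable sequence. For nets $N_1,N_2$ with place sets $P_1,P_2$ (which may share places) and a Presburger formula $E$ with free variables in $P_1\cup P_2$, and markings $m_1\in\mathbb N^{P_1}$, $m_2\in\mathbb N^{P_2}$, write $m_1\equiv_E m_2$ if $m_1$ and $m_2$ agree on $P_1\cap P_2$ and the assignment $m_1\cup m_2$ of the variables $P_1\cup P_2$ satisfies $E$ over $\mathbb N$. $(N_1,m_1)\sqsubseteq_E(N_2,m_2)$ ($E$-abstraction) means: (A1) $m_1\equiv_E m_2$; and (A2) for every observable sequence $(N_1,m_1)\xRightarrow{\sigma}(N_1,m_1')$ there is at least one marking $m_2'\in\mathbb N^{P_2}$ with $m_1'\equiv_E m_2'$, and for every marking $m_2'\in\mathbb N^{P_2}$ with $m_1'\equiv_E m_2'$ we have $(N_2,m_2)\xRightarrow{\sigma}(N_2,m_2')$. Finally $(N_1,m_1)\equiv_E(N_2,m_2)$ means both $(N_1,m_1)\sqsubseteq_E(N_2,m_2)$ and $(N_2,m_2)\sqsubseteq_E(N_1,m_1)$. *)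

(* Defs.v *)
From HB Require Import structures.
From mathcomp Require Import all_boot all_order.
From mathcomp Require Import finmap.

Set Implicit Arguments.
Unset Strict Implicit.
Unset Printing Implicit Defensive.

(** * Labeled Petri nets *)

(* Place names live in [nat], so that two nets can share places.  The set of
   transitions is ['I_(ntrans N)].  The alphabet is [nat]; [None] is the silent
   action tau. *)
Record net := Net {
  places : {fset nat};
  ntrans : nat;
  pre : {ffun 'I_ntrans -> {ffun places -> nat}};
  post : {ffun 'I_ntrans -> {ffun places -> nat}};
  label : {ffun 'I_ntrans -> option nat}
}.

Definition marking (N : net) := {ffun places N -> nat}.

Definition enabled (N : net) (m : marking N) (t : 'I_(ntrans N)) : Prop :=
  forall p : places N, pre N t p <= m p.

Definition fires (N : net) (m : marking N) (t : 'I_(ntrans N))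
    (m' : marking N) : Prop :=
  enabled m t /\ m' = [ffun p => m p - pre N t p + post N t p].

Fixpoint fires_seq (N : net) (m : marking N) (rho : seq 'I_(ntrans N))
    (m' : marking N) : Prop :=
  if rho is t :: rho' then exists2 m1, fires m t m1 & fires_seq m1 rho' m'
  else m' = m.

(* [pmap] drops the transitions labeled [None]. *)
Definition obs_label (N : net) (rho : seq 'I_(ntrans N)) : seq nat :=
  pmap (label N) rho.

Definition observable (N : net) (m : marking N) (sigma : seq nat)
    (m' : marking N) : Prop :=
  exists2 rho, fires_seq m rho m' & obs_label rho = sigma.

(** * Presburger formulas, with named variables *)

Inductive term :=
  | Var of nat
  | Zero
  | One
  | Add of term & term.

Inductive formula :=
  | Eq of term & term
  | Le of term & term
  | Not of formula
  | And of formula & formula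
  | Or of formula & formula
  | Exists of nat & formula
  | Forall of nat & formula.

Fixpoint term_vars (t : term) : seq nat :=
  match t with
  | Var x => [:: x]
  | Zero | One => [::]
  | Add t u => term_vars t ++ term_vars u
  end.

Fixpoint free_vars (F : formula) : seq nat :=
  match F with
  | Eq t u | Le t u => term_vars t ++ term_vars u
  | Not G => free_vars G
  | And G H | Or G H => free_vars G ++ free_vars H
  | Exists x G | Forall x G => [seq y <- free_vars G | y != x]
  end.

Definition update (v : nat -> nat) (x n : nat) : nat -> nat :=
  fun y => if y == x then n else v y.

Fixpoint eval (v : nat -> nat) (t : term) : nat :=
  match t with
  | Var x => v x
  | Zero => 0
  | One => 1
  | Add t u => eval v t + eval v u
  end.

Fixpoint sat (v : nat -> nat) (F : formula) : Prop :=
  match F with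
  | Eq t u => eval v t = eval v u
  | Le t u => eval v t <= eval v u
  | Not G => ~ sat v G
  | And G H => sat v G /\ sat v H
  | Or G H => sat v G \/ sat v H
  | Exists x G => exists n, sat (update v x n) G
  | Forall x G => forall n, sat (update v x n) G
  end.

(** * E-abstraction *)

(* The value at [p], with junk value 0 when [p] is not in [P]. *)
Definition tokens (P : {fset nat}) (m : {ffun P -> nat}) (p : nat) : nat :=
  if insub p is Some q then m q else 0.

Definition agree (N1 N2 : net) (m1 : marking N1) (m2 : marking N2) : Prop :=
  forall p, p \in (places N1 `&` places N2)%fset -> tokens m1 p = tokens m2 p.

(* The valuation [m1 \cup m2]; meaningful when [m1] and [m2] agree. *)
Definition union_val (N1 N2 : net) (m1 : marking N1) (m2 : marking N2) :
    nat -> nat :=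
  fun p => if p \in places N1 then tokens m1 p else tokens m2 p.

Definition marking_equiv (E : formula) (N1 N2 : net)
    (m1 : marking N1) (m2 : marking N2) : Prop :=
  agree m1 m2 /\ sat (union_val m1 m2) E.

Definition abstraction (E : formula) (N1 N2 : net)
    (m1 : marking N1) (m2 : marking N2) : Prop :=
  marking_equiv E m1 m2 /\
  (forall (sigma : seq nat) (m1' : marking N1), observable m1 sigma m1' ->
     (exists m2' : marking N2, marking_equiv E m1' m2') /\
     (forall m2' : marking N2,
        marking_equiv E m1' m2' -> observable m2 sigma m2')).

Definition net_equiv (E : formula) (N1 N2 : net)
    (m1 : marking N1) (m2 : marking N2) : Prop :=
  abstraction E m1 m2 /\ abstraction E m2 m1.

(** * Algorithms: register machines *)

(* Minsky / Shepherdson-Sturgis machines with unboundedly many registers: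
   [Inc r] increments register [r]; [DecJz r j] jumps to instruction [j] if
   register [r] is zero, and decrements it otherwise. *)
Inductive instr :=
  | Inc of nat
  | DecJz of nat & nat.

Definition program := seq instr.

(* Program counter and register contents. *)
Definition config := (nat * (nat -> nat))%type.

(* Halted configurations, whose program counter is outside the program, are
   fixed points. *)
Definition step (M : program) (c : config) : config :=
  let: (pc, R) := c in
  match onth M pc with
  | None => c
  | Some (Inc r) => (pc.+1, update R r (R r).+1)
  | Some (DecJz r j) =>
      if R r is n.+1 then (pc.+1, update R r n) else (j, R)
  end.

(* The input is given in register 0, all other registers being zero; the output
   is read from register 0. *)
Definition input (x : nat) : config := (0, update (fun=> 0) 0 x).

Definition outputs (M : program) (x y : nat) : Prop :=
  exists k, let c := iter k (step M) (input x) in size M <= c.1 /\ c.2 0 = y.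

(** * Effective numbering of the instances *)

(* All finite data are coded with the library's computable bijection
   [CodeSeq.code : seq nat -> nat]; a vector indexed by a set of places lists its
   entries by increasing place name. *)

Record instance := Instance {
  net1 : net;
  net2 : net;
  mark1 : marking net1;
  mark2 : marking net2;
  constraint : formula
}.

Definition code_vector (P : {fset nat}) (m : {ffun P -> nat}) : nat :=
  CodeSeq.code [seq tokens m p | p <- sort leq P].

Definition code_label (a : option nat) : nat := if a is Some n then n.+1 else 0.

Definition code_trans (N : net) (t : 'I_(ntrans N)) : nat :=
  CodeSeq.code
    [:: code_vector (pre N t); code_vector (post N t); code_label (label N t)].

Definition code_net (N : net) : nat :=
  CodeSeq.code
    [:: CodeSeq.code (sort leq (places N));
        CodeSeq.code [seq code_trans t | t <- enum 'I_(ntrans N)]].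

Fixpoint code_term (t : term) : nat :=
  match t with
  | Var x => CodeSeq.code [:: 0; x]
  | Zero => CodeSeq.code [:: 1]
  | One => CodeSeq.code [:: 2]
  | Add t u => CodeSeq.code [:: 3; code_term t; code_term u]
  end.

Fixpoint code_formula (F : formula) : nat :=
  match F with
  | Eq t u => CodeSeq.code [:: 0; code_term t; code_term u]
  | Le t u => CodeSeq.code [:: 1; code_term t; code_term u]
  | Not G => CodeSeq.code [:: 2; code_formula G]
  | And G H => CodeSeq.code [:: 3; code_formula G; code_formula H]
  | Or G H => CodeSeq.code [:: 4; code_formula G; code_formula H]
  | Exists x G => CodeSeq.code [:: 5; x; code_formula G]
  | Forall x G => CodeSeq.code [:: 6; x; code_formula G]
  end.

Definition code_instance (I : instance) : nat :=
  CodeSeq.code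
    [:: code_vector (mark1 I); code_vector (mark2 I);
        code_net (net1 I); code_net (net2 I); code_formula (constraint I)].

(* Distinct instances have distinct codes. *)

Lemma code_inj : injective CodeSeq.code.
Proof. exact: can_inj CodeSeq.codeK. Qed.

Lemma code_vector_inj (P : {fset nat}) : injective (@code_vector P).
Proof.
move=> m m' /code_inj eqmm'; apply/ffunP=> p.
have /(_ (val p)): {in sort leq P, tokens m =1 tokens m'} by apply/eq_in_map.
by rewrite mem_sort (valP p) /tokens valK; apply.
Qed.

Lemma code_label_inj : injective code_label.
Proof. by case=> [n|] [n'|] //= [->]. Qed.

Lemma code_net_inj : injective code_net.
Proof.
move=> [P n pr po l] [P' n' pr' po' l'] /code_inj[/= /code_inj eqP /code_inj eqT].
have eqPP : P = P'.
  by apply/fsetP=> p; rewrite -(mem_sort leq P) eqP mem_sort.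
case: _ / eqPP in pr' po' eqT {eqP} *.
have eqn : n = n' by have := congr1 size eqT; rewrite 2!size_map !size_enum_ord.
case: _ / eqn in pr' po' l' eqT *.
have eqt (t : 'I_n) :
    [/\ pr t = pr' t, po t = po' t & l t = l' t].
  move/eq_in_map/(_ t): eqT; rewrite mem_enum => /(_ isT) /code_inj[/=].
  by move=> /code_vector_inj-> /code_vector_inj-> /code_label_inj->.
by congr Net; apply/ffunP=> t; case: (eqt t).
Qed.

Lemma code_term_inj : injective code_term.
Proof.
elim=> [x|||t IHt u IHu] [x'|||t' u'] // /code_inj[] //; first by move->.
by move=> /IHt-> /IHu->.
Qed.

Lemma code_formula_inj : injective code_formula.
Proof.
elim=> [t u|t u|G IHG|G IHG H IHH|G IHG H IHH|x G IHG|x G IHG]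
  [t' u'|t' u'|G'|G' H'|G' H'|x' G'|x' G'] // /code_inj[] //.
- by move=> /code_term_inj-> /code_term_inj->.
- by move=> /code_term_inj-> /code_term_inj->.
- by move=> /IHG->.
- by move=> /IHG-> /IHH->.
- by move=> /IHG-> /IHH->.
- by move=> -> /IHG->.
- by move=> -> /IHG->.
Qed.

Lemma code_instance_inj : injective code_instance.
Proof.
move=> [N1 N2 m1 m2 E] [N1' N2' m1' m2' E'] /code_inj[/= + +].
move=> + + /code_net_inj e1 /code_net_inj e2 /code_formula_inj->.
case: _ / e1 in m1' *; case: _ / e2 in m2' *.
by move=> /code_vector_inj-> /code_vector_inj->.
Qed.

(* Main.v *)
(* A register machine D is turned into two nets that guess the outcome of each zero
   test and show it in the labels; one bit of the control state, the flag, may be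
   raised when a test passes as zero on a nonzero register.  The nets have the same
   places and differ by one silent transition, which raises the flag for free at the
   halting state.  A run using it has a counterpart without it unless no zero test
   was guessed wrongly, that is, unless it is the halting computation of D; so with
   a trivial constraint the nets are equivalent iff D does not halt.

   Against a decider M, take for D the program that builds the code of its own
   instance, runs M on it, and halts iff the answer is 1.  No recursion theorem is
   needed: only the initial marking of the instance depends on the input of D, so
   this input can be the code of the two nets of D. *)

From Stdlib Require Import FunctionalExtensionality.
Require Import Defs.
From mathcomp Require Import all_boot all_order.
From mathcomp Require Import finmap.

Set Implicit Arguments.
Unset Strict Implicit.
Unset Printing Implicit Defensive.

(** * Register machines *)

Lemma updateE v x n y : update v x n y = if y == x then n else v y.
Proof. by []. Qed.

Lemma update_id v x : update v x (v x) = v.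
Proof.
by apply: functional_extensionality => y; rewrite updateE; case: eqP => [->|].
Qed.

Definition reaches (M : program) (c c' : config) : Prop :=
  exists k, iter k (step M) c = c'.

Definition halts (M : program) (c : config) : Prop :=
  exists k, size M <= (iter k (step M) c).1.

Lemma reaches_refl M c : reaches M c c.
Proof. by exists 0. Qed.

Lemma reaches_trans M c2 c1 c3 :
  reaches M c1 c2 -> reaches M c2 c3 -> reaches M c1 c3.
Proof. by move=> [k <-] [l <-]; exists (l + k); rewrite iterD. Qed.

Lemma reaches_step M c c' : reaches M (step M c) c' -> reaches M c c'.
Proof. by move=> [k <-]; exists k.+1; rewrite iterSr. Qed.

Lemma step_halted M c : size M <= c.1 -> step M c = c.
Proof. by case: c => pc R /= /onth_default ->. Qed.

Lemma iter_fixpoint (T : Type) (f : T -> T) x n : f x = x -> iter n f x = x.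
Proof. by move=> fx; elim: n => //= n ->. Qed.

Lemma reaches_halts M c c' : reaches M c c' -> size M <= c'.1 -> halts M c.
Proof. by move=> [k <-]; exists k. Qed.

(** Iterates of [step] commute, so a halted configuration and a fixed point reached from the same
    start would be equal. *)
Lemma reaches_fixpoint_nhalts M c c' :
  reaches M c c' -> step M c' = c' -> c'.1 < size M -> ~ halts M c.
Proof.
move=> [k kc'] fix_c' lt_c' [l halt_l].
have : iter l (step M) c' = iter k (step M) (iter l (step M) c).
  by rewrite -kc' -!iterD addnC.
rewrite (iter_fixpoint l fix_c') (iter_fixpoint k (step_halted halt_l)) => E.
by move: halt_l; rewrite -E leqNgt lt_c'.
Qed.

(** * Loop programs *)

Inductive loop_cmd :=
  | LInc of nat
  | LSeq of loop_cmd & loop_cmd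
  | LLoop of nat & loop_cmd.

Fixpoint written (c : loop_cmd) : seq nat :=
  match c with
  | LInc r => [:: r]
  | LSeq c d => written c ++ written d
  | LLoop r c => r :: written c
  end.

Fixpoint well_formed (c : loop_cmd) : bool :=
  match c with
  | LInc _ => true
  | LSeq c d => well_formed c && well_formed d
  | LLoop r c => (r \notin written c) && well_formed c
  end.

(** The number of passes is fixed at entry; [well_formed] keeps the body from writing the counter,
    so the compiled loop makes exactly that many. *)
Fixpoint loop_sem (c : loop_cmd) (R : nat -> nat) : nat -> nat :=
  match c with
  | LInc r => update R r (R r).+1
  | LSeq c d => loop_sem d (loop_sem c R)
  | LLoop r c => iter (R r) (fun R => loop_sem c (update R r (R r).-1)) R
  end.

(* The register [z], assumed to hold zero, turns [DecJz] into an unconditional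
   jump; [o] is the address of the first instruction. *)
Fixpoint compile (z o : nat) (c : loop_cmd) : program :=
  match c with
  | LInc r => [:: Inc r]
  | LSeq c d => let p := compile z o c in p ++ compile z (o + size p) d
  | LLoop r c =>
      let p := compile z o.+1 c in DecJz r (o + (size p).+2) :: rcons p (DecJz z o)
  end.

Lemma loop_sem_unwritten c R r : r \notin written c -> loop_sem c R r = R r.
Proof.
elim: c R => [s|c IHc d IHd|s c IHc] R /=.
- by rewrite inE updateE => /negPf ->.
- by rewrite mem_cat negb_or => /andP[rc rd]; rewrite IHd // IHc.
rewrite inE negb_or => /andP[/negPf rs rc].
elim: (R s) => //= n <-.
by rewrite IHc // updateE rs.
Qed.

Lemma onth_middle (T : Type) (p q : seq T) x : onth (p ++ x :: q) (size p) = Some x.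
Proof. by rewrite onth_cat ltnn subnn. Qed.

(** The context [p], [q] is arbitrary for the induction: jump addresses are absolute and subcommands
    sit inside other code. *)
Lemma compile_correct z c p q R :
    well_formed c -> z \notin written c -> R z = 0 ->
  reaches (p ++ compile z (size p) c ++ q) (size p, R)
    (size p + size (compile z (size p) c), loop_sem c R).
Proof.
elim: c p q R => [r|c IHc d IHd|r c IHc] p q R /=.
- by move=> _ _ _; exists 1; rewrite /= onth_middle addn1.
- rewrite mem_cat negb_or => /andP[wc wd] /andP[zc zd] Rz.
  apply: reaches_trans; first by rewrite -catA; apply: IHc.
  rewrite size_cat -size_cat addnA -size_cat -catA [p ++ _]catA.
  by apply: IHd => //; rewrite loop_sem_unwritten.
rewrite inE negb_or => /andP[rc wc] /andP[_ zc] Rz.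
set s := compile z _ c; rewrite size_rcons cat_rcons.
set D := p ++ _.
move Rr: (R r) => n; elim: n R Rz Rr => [|n IHn] R Rz Rr.
  by exists 1; rewrite /= onth_middle Rr.
apply: reaches_step; rewrite /step onth_middle Rr iterSr Rr.
have zr : (z == r) = false.
  by apply/eqP => e; move: Rr; rewrite -e Rz.
have := IHc (rcons p (DecJz r (size p + (size s).+2))) (DecJz z (size p) :: q)
  (update R r n) wc zc.
rewrite updateE zr size_rcons cat_rcons -/s -/D => /(_ Rz) body.
apply: reaches_trans body _.
have back : onth D ((size p).+1 + size s) = Some (DecJz z (size p)).
  rewrite /D -cat_cons catA.
  by rewrite -[RHS](onth_middle (p ++ DecJz r (size p + (size s).+2) :: s) q)
             size_cat addSnnS.
(* The back jump is taken because the body leaves zero in [z]. *)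
apply: reaches_step; rewrite /step back.
rewrite loop_sem_unwritten // updateE zr Rz.
apply: IHn; rewrite loop_sem_unwritten // updateE ?zr ?eqxx //.
Qed.

Lemma loop_loopE r c R :
  loop_sem (LLoop r c) R = iter (R r) (fun S => loop_sem c (update S r (S r).-1)) R.
Proof. by []. Qed.

Lemma loop_seqE c d R : loop_sem (LSeq c d) R = loop_sem d (loop_sem c R).
Proof. by []. Qed.

(** * Loop programs for sequence codes *)

Definition copy_cmd (a b c : nat) := LLoop a (LSeq (LInc b) (LInc c)).

Definition double_cmd (b t : nat) := LSeq (copy_cmd b t t) (LLoop t (LInc b)).

(** [CodeSeq.code (n :: s)] is [2 ^ n * (CodeSeq.code s).*2.+1]: from [n] in [a] and the code of [s]
    in [b], this puts the code of [n :: s] in [b], with [t] as scratch. *)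
Definition cons_cmd (a b t : nat) :=
  LSeq (double_cmd b t) (LSeq (LInc b) (LLoop a (double_cmd b t))).

Lemma move_sem a b R :
  a != b -> loop_sem (LLoop a (LInc b)) R = update (update R a 0) b (R b + R a).
Proof.
rewrite /= => /negPf ab; move Ra: (R a) => n.
elim: n R Ra => [|n IHn] R Ra.
  by rewrite addn0 -[in RHS]Ra update_id update_id.
have ba : (b == a) = false by rewrite eq_sym.
rewrite iterSr IHn /= ?updateE ?(ab, ba, eqxx) ?Ra //.
apply: functional_extensionality => y; rewrite !updateE.
by do !case: ifP => //; rewrite addSnnS.
Qed.

Lemma copy_sem a b c R : a != b -> a != c -> b != c ->
  loop_sem (copy_cmd a b c) R =
  update (update (update R a 0) b (R b + R a)) c (R c + R a).
Proof.
rewrite /= => /negPf ab /negPf ac /negPf bc; move Ra: (R a) => n.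
elim: n R Ra => [|n IHn] R Ra.
  by rewrite !addn0 -[in RHS]Ra update_id update_id update_id.
have ba : (b == a) = false by rewrite eq_sym.
have ca : (c == a) = false by rewrite eq_sym.
have cb : (c == b) = false by rewrite eq_sym.
rewrite iterSr IHn /= ?updateE ?(ab, ac, ba, ca, cb, bc, eqxx) ?Ra //.
apply: functional_extensionality => y; rewrite !updateE.
by do !case: ifP => //; rewrite addSnnS.
Qed.

Lemma copy2_sem a b R : a != b ->
  loop_sem (copy_cmd a b b) R = update (update R a 0) b (R b + (R a).*2).
Proof.
rewrite /= => /negPf ab; move Ra: (R a) => n.
elim: n R Ra => [|n IHn] R Ra.
  by rewrite addn0 -[in RHS]Ra update_id update_id.
have ba : (b == a) = false by rewrite eq_sym.
rewrite iterSr IHn /= ?updateE ?(ab, ba, eqxx) ?Ra //.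
apply: functional_extensionality => y; rewrite !updateE.
by do !case: ifP => //; rewrite doubleS !addSnnS.
Qed.

Lemma double_sem b t R : b != t -> R t = 0 ->
  loop_sem (double_cmd b t) R = update R b (R b).*2.
Proof.
move=> bt Rt; rewrite loop_seqE.
rewrite copy2_sem // move_sem 1?eq_sym // Rt.
apply: functional_extensionality => y; rewrite !updateE !eqxx (negPf bt).
case: (y =P b) => [_|_] //; case: (y =P t) => [->|] //.
Qed.

Lemma cons_sem a b t R : a != b -> a != t -> b != t -> R t = 0 ->
  loop_sem (cons_cmd a b t) R =
  update (update R a 0) b (2 ^ R a * (R b).*2.+1).
Proof.
move=> ab at_ bt Rt; rewrite 2!loop_seqE.
rewrite double_sem //.
set R1 := loop_sem (LInc b) _.
have -> : R1 = update R b (R b).*2.+1.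
  by apply: functional_extensionality => y; rewrite /R1 /= !updateE eqxx; case: eqP.
(* The goal is rewritten in terms of the registers just before the loop, which are then generalized
   for the induction on the content of [a]. *)
have -> : 2 ^ R a * (R b).*2.+1 = 2 ^ R a * (update R b (R b).*2.+1) b.
  by rewrite updateE eqxx.
have -> : R a = update R b (R b).*2.+1 a by rewrite updateE (negPf ab).
have {Rt} : update R b (R b).*2.+1 t = 0 by rewrite updateE eq_sym (negPf bt).
have -> : update (update R a 0) b = update (update (update R b (R b).*2.+1) a 0) b.
  apply: functional_extensionality => n; apply: functional_extensionality => y.
  by rewrite !updateE; do !case: eqP.
move: (update R b _) => {R1}R Rt.
rewrite loop_loopE.
move Ra: (R a) => n; elim: n R Ra Rt => [|n IHn] R Ra Rt.
  by rewrite mul1n -[in RHS]Ra update_id update_id.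
have ta : (t == a) = false by rewrite eq_sym (negPf at_).
have ba : (b == a) = false by rewrite eq_sym (negPf ab).
have tb : (t == b) = false by rewrite eq_sym (negPf bt).
rewrite iterSr double_sem ?updateE ?ta //.
rewrite IHn ?updateE ?(negPf ab, eqxx, ta, tb) ?Ra //.
apply: functional_extensionality => y; rewrite !updateE ba ?eqxx.
by do !case: ifP => //; rewrite expnS -mul2n mulnA [2 * _]mulnC.
Qed.

(** * The diagonal program *)

(* Starting from [x] in register 0 and [c] in register 1, computes in register 0
   the code of [v :: v :: s], where [x] is the code of [s] and [v] that of
   [x :: c :: t], with [c] the code of [t]. *)
Definition self_code_cmd : loop_cmd :=
  LSeq (copy_cmd 1 2 3) (LSeq (cons_cmd 2 3 4) (LSeq (copy_cmd 0 1 2)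
  (LSeq (cons_cmd 1 3 4) (LSeq (copy_cmd 3 0 1) (LSeq (cons_cmd 0 2 4)
  (LSeq (cons_cmd 1 2 4) (LLoop 2 (LInc 0)))))))).

Definition two_inputs (x c : nat) : nat -> nat := nth 0 [:: x; c].

(** Register 3 goes from [c] to [v]; register 2, reloaded with the tail [x], then receives [v]
    twice. *)
Lemma self_code_sem s t :
  let x := CodeSeq.code s in
  let c := CodeSeq.code t in
  let v := CodeSeq.code [:: x, c & t] in
  loop_sem self_code_cmd (two_inputs x c) =
  update (fun=> 0) 0 (CodeSeq.code [:: v, v & s]).
Proof.
move=> x c v; rewrite loop_seqE copy_sem // loop_seqE cons_sem // loop_seqE copy_sem //.
rewrite loop_seqE cons_sem // loop_seqE copy_sem // loop_seqE cons_sem //.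
rewrite loop_seqE cons_sem // move_sem //.
by apply: functional_extensionality => -[|[|[|[|[|y]]]]].
Qed.

(** Jumps out of [M] are redirected to the address just after the block, so that halting becomes
    falling through. *)
Definition relocate (o : nat) (M : program) : program :=
  [seq match i with
       | Inc r => Inc r
       | DecJz r j => DecJz r (o + minn j (size M))
       end | i <- M].

Lemma relocate_correct M p q R k :
  let c := iter k (step M) (0, R) in
  reaches (p ++ relocate (size p) M ++ q) (size p, R)
    (size p + minn c.1 (size M), c.2).
Proof.
elim: k => [|k IHk] /=; first by rewrite min0n addn0; apply: reaches_refl.
apply: reaches_trans IHk _.
case: (iter k _ _) => pc S; case: (leqP (size M) pc) => [le_pc|lt_pc].
  by rewrite step_halted //= (minn_idPr le_pc); apply: reaches_refl.
exists 1.
rewrite /= onth_cat ltnNge leq_addr /= addKn onth_cat size_map lt_pc onth_map.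
have := onthTE M pc; rewrite lt_pc; case: (onth M pc) => //= -[r|r j] _ /=.
  by rewrite (minn_idPl lt_pc) addnS.
by case: (S r) => [|n] //=; rewrite (minn_idPl lt_pc) addnS.
Qed.

(** Register 5 can serve as zero register: the command uses only 0 to 4. *)
Definition prelude : program := compile 5 0 self_code_cmd.

(** The last instruction jumps to itself while register 0 is zero; on a positive output it falls off
    the end. *)
Definition diagonal (M : program) : program :=
  (prelude ++ relocate (size prelude) M) ++ [:: DecJz 0 (size prelude + size M)].

Lemma size_diagonal M : size (diagonal M) = (size prelude + size M).+1.
Proof. by rewrite /diagonal; move: prelude => p; rewrite !size_cat size_map addn1. Qed.

Section Diagonal.

Variables (M : program) (s t : seq nat).
Let x := CodeSeq.code s.
Let c := CodeSeq.code t.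
Let v := CodeSeq.code [:: x, c & t].
Let y := CodeSeq.code [:: v, v & s].

Lemma diagonal_reaches b : outputs M y b ->
  exists2 R, R 0 = b & reaches (diagonal M) (0, two_inputs x c)
                         ((size (diagonal M)).-1, R).
Proof.
move=> [k [halt_k out_k]]; exists (iter k (step M) (input y)).2 => //.
have start : reaches (diagonal M) (0, two_inputs x c)
                   (size prelude, update (fun=> 0) 0 y).
  rewrite -self_code_sem /diagonal -catA.
  exact: (@compile_correct 5 self_code_cmd [::] _ _ isT isT erefl).
apply: reaches_trans start _.
rewrite size_diagonal /diagonal -catA; move: prelude => p.
have /= := relocate_correct M p [:: DecJz 0 (size p + size M)]
  (update (fun=> 0) 0 y) k.
by rewrite -/(input y) (minn_idPr halt_k).
Qed.

Lemma onth_diagonal :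
  onth (diagonal M) (size (diagonal M)).-1 =
  Some (DecJz 0 (size (diagonal M)).-1).
Proof.
rewrite size_diagonal /diagonal; move: prelude => p.
by rewrite onth_cat size_cat size_map ltnn subnn.
Qed.

Lemma diagonal_halts : outputs M y 1 -> halts (diagonal M) (0, two_inputs x c).
Proof.
move=> /diagonal_reaches[R R0]; have := onth_diagonal.
rewrite size_diagonal succnK => D_n reach_n.
apply: (@reaches_halts _ _ (size (diagonal M), update R 0 0)) => //.
apply: reaches_trans reach_n _.
by exists 1; rewrite /iter /step D_n R0 size_diagonal.
Qed.

Lemma diagonal_loops : outputs M y 0 -> ~ halts (diagonal M) (0, two_inputs x c).
Proof.
move=> /diagonal_reaches[R R0] /reaches_fixpoint_nhalts; apply.
  by rewrite /step onth_diagonal R0.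
by rewrite -onthTE onth_diagonal.
Qed.

End Diagonal.

(** * Nets from counter transitions *)

(* [(a, (q, q'), (r, (d, i)))]: labeled [a], moves the control state from [q] to
   [q'], takes [d] tokens from register [r] and puts [i] tokens there. *)
Definition ctrans : Type :=
  (option nat * (nat * nat) * (nat * (nat * nat)))%type.

Definition ct_label (t : ctrans) := t.1.1.
Definition ct_src (t : ctrans) := t.1.2.1.
Definition ct_dst (t : ctrans) := t.1.2.2.
Definition ct_reg (t : ctrans) := t.2.1.
Definition ct_dec (t : ctrans) := t.2.2.1.
Definition ct_inc (t : ctrans) := t.2.2.2.

Section CounterNet.

(* [K] registers; the control states are the numbers up to [L]. *)
Variables K L : nat.

Definition ct_wf (t : ctrans) : bool :=
  [&& ct_src t <= L, ct_dst t <= L & ct_reg t < K].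

Definition counter_places : {fset nat} := [fset p in iota 0 K.+2]%fset.

(* The places below [K] are the registers.  Place [K] holds the control state [q]
   and place [K.+1] the complement [L - q]: a transition consuming [q] tokens from
   the first and [L - q] from the second is enabled in state [q] only. *)
Definition place_value (q : nat) (R : nat -> nat) (p : nat) : nat :=
  if p < K then R p else if p == K then q else L - q.

Definition counter_marking (q : nat) (R : nat -> nat) :
    {ffun counter_places -> nat} :=
  [ffun p => place_value q R (val p)].

Definition counter_net (ts : seq ctrans) : net :=
  @Net counter_places (size ts)
    [ffun k => let t := tnth (in_tuple ts) k in
       counter_marking (ct_src t) (update (fun=> 0) (ct_reg t) (ct_dec t))]
    [ffun k => let t := tnth (in_tuple ts) k in
       counter_marking (ct_dst t) (update (fun=> 0) (ct_reg t) (ct_inc t))]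
    [ffun k => ct_label (tnth (in_tuple ts) k)].

Lemma in_counter_places p : (p \in counter_places) = (p < K.+2).
Proof. by rewrite in_fset mem_iota. Qed.

Lemma forall_counter_places (P : nat -> Prop) :
  (forall p : counter_places, P (val p)) <-> (forall p, p < K.+2 -> P p).
Proof.
split=> [allP p|allP p]; last by apply: allP; rewrite -in_counter_places (valP p).
by rewrite -in_counter_places => pP; apply: (allP [` pP]%fset).
Qed.

Lemma tokens_counter_marking q R p :
  p < K.+2 -> tokens (counter_marking q R) p = place_value q R p.
Proof.
by rewrite -in_counter_places /tokens => pP; rewrite insubT ffunE.
Qed.

Lemma sort_counter_places : sort leq counter_places = iota 0 K.+2.
Proof.
apply: (sorted_eq leq_trans anti_leq).
- exact: sort_sorted leq_total _.
- exact: iota_sorted.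
apply: uniq_perm; rewrite ?sort_uniq ?iota_uniq ?fset_uniq // => p.
by rewrite mem_sort in_counter_places mem_iota.
Qed.

Lemma counter_marking_state q q' R R' :
  counter_marking q R = counter_marking q' R' -> q = q'.
Proof.
move=> /(congr1 (fun m => tokens m K)).
by rewrite !tokens_counter_marking // /place_value ltnn eqxx.
Qed.

Lemma counter_fires (ts : seq ctrans) (k : 'I_(ntrans (counter_net ts))) q R m' :
  let t := tnth (in_tuple ts) k in
  ct_wf t -> q <= L ->
  @fires (counter_net ts) (counter_marking q R) k m' <->
  [/\ q = ct_src t, ct_dec t <= R (ct_reg t) &
      m' = counter_marking (ct_dst t)
             (update R (ct_reg t) (R (ct_reg t) - ct_dec t + ct_inc t))].
Proof.
move=> t /and3P[srcL dstL regK] qL; rewrite /fires /enabled.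
set pr := update (fun=> 0) (ct_reg t) (ct_dec t).
set po := update (fun=> 0) (ct_reg t) (ct_inc t).
have enabledE : (forall p, pre (counter_net ts) k p <= counter_marking q R p) <->
    (forall p, p < K.+2 -> place_value (ct_src t) pr p <= place_value q R p).
  rewrite -forall_counter_places.
  by split=> h p; have := h p; rewrite !ffunE /= ?ffunE.
have fireE : q = ct_src t ->
    [ffun p => counter_marking q R p - pre (counter_net ts) k p
               + post (counter_net ts) k p] =
    counter_marking (ct_dst t)
      (update R (ct_reg t) (R (ct_reg t) - ct_dec t + ct_inc t)).
  move=> ->; apply/ffunP=> p; rewrite !ffunE /= ?ffunE -/t /place_value /update.
  case: ifP => _; first by case: eqP => [->|] //; rewrite subn0 addn0.
  by case: ifP => _; rewrite subnn add0n.
split=> [[/enabledE en ->]|[eq_q le_dec ->]].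
  have eq_q : q = ct_src t.
    (* Place [K] gives [ct_src t <= q], and the complementary place gives the converse. *)
    have := en K (leqnSn _); have := en K.+1 (leqnn _).
    rewrite /place_value !ltnn eqxx ltnNge leqnSn /= gtn_eqF // leq_sub2lE //.
    by move=> ? ?; apply/eqP; rewrite eqn_leq; apply/andP.
  split=> //; last exact: fireE.
  have := en (ct_reg t) (leq_trans regK (leq_trans (leqnSn _) (leqnSn _))).
  by rewrite /place_value regK /pr updateE eqxx.
split; last by rewrite fireE.
apply/enabledE => p _; rewrite /place_value eq_q; case: ifP => // _.
by rewrite /pr updateE; case: eqP => [->|].
Qed.

End CounterNet.

Lemma fires_seq_rcons (N : net) (m m' : marking N) rho t :
  fires_seq m (rcons rho t) m' <-> exists2 m1, fires_seq m rho m1 & fires m1 t m'.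
Proof.
elim: rho m => [|u rho IH] m /=.
  by split=> [[m1 ? ->]|[m1 -> ?]]; [exists m | exists m'].
split=> [[m1 mu /IH[m2 ? ?]]|[m2 [m1 mu ?] ?]].
  by exists m2 => //; exists m1.
by exists m1 => //; apply/IH; exists m2.
Qed.

Lemma obs_label_rcons (N : net) (rho : seq 'I_(ntrans N)) t :
  obs_label (rcons rho t) =
  if label N t is Some a then rcons (obs_label rho) a else obs_label rho.
Proof.
rewrite /obs_label -cats1 pmap_cat /=.
by case: (label N t) => [a|]; rewrite /= ?cats1 ?cats0.
Qed.

Lemma observable_fires (N : net) (m m1 m' : marking N) sigma (t : 'I_(ntrans N)) :
  observable m sigma m1 -> fires m1 t m' ->
  observable m (if label N t is Some a then rcons sigma a else sigma) m'.
Proof.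
move=> [rho mm1 <-] m1m'; exists (rcons rho t); last exact: obs_label_rcons.
by apply/fires_seq_rcons; exists m1.
Qed.

(** * Machine nets *)

Definition reg_of (i : instr) : nat := match i with Inc r | DecJz r _ => r end.

Section MachineNet.

Variables (K : nat) (D : program) (R0 : nat -> nat).
Hypothesis K_gt0 : 0 < K.
Hypothesis regsK : all (fun i => reg_of i < K) D.

Let H := size D.
Let L := H.*2.+1.

(* The flag [F] claims that some zero test has been passed with a nonzero
   register. *)
Definition state (pc : nat) (F : bool) : nat := (minn pc H).*2 + F.

(** Nets cannot test for zero: the second transition of [DecJz] jumps whatever the register holds.
    The third takes a token and puts it back, so it certifies that the jump is wrong. *)
Definition instr_trans (pc : nat) (F : bool) (i : instr) : seq ctrans :=
  match i with
  | Inc r => [:: (Some 0, (state pc F, state pc.+1 F), (r, (0, 1)))]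
  | DecJz r j =>
      [:: (Some 0, (state pc F, state pc.+1 F), (r, (1, 0)));
          (Some 1, (state pc F, state j F), (r, (0, 0)));
          (Some 1, (state pc F, state j true), (r, (1, 1)))]
  end.

(* The two nets differ by one silent transition, which lets the first one raise
   the flag for free once the machine has halted. *)
Definition machine_trans (free : bool) : seq ctrans :=
  (if free then [:: (None, (state H false, state H true), (0, (0, 0)))] else [::])
  ++ flatten [seq instr_trans pc F (nth (Inc 0) D pc)
              | pc <- iota 0 H, F <- [:: false; true]].

Definition machine_net (free : bool) : net := counter_net K L (machine_trans free).

Definition machine_marking (pc : nat) (F : bool) (R : nat -> nat) :
    {ffun counter_places K -> nat} :=
  counter_marking K L (state pc F) R.

Inductive lstep (pc : nat) (F : bool) (R : nat -> nat) :
    nat -> nat -> bool -> (nat -> nat) -> Prop :=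
  | LstepInc r : onth D pc = Some (Inc r) ->
      lstep pc F R 0 pc.+1 F (update R r (R r).+1)
  | LstepDec r j n : onth D pc = Some (DecJz r j) -> R r = n.+1 ->
      lstep pc F R 0 pc.+1 F (update R r n)
  | LstepJump r j : onth D pc = Some (DecJz r j) -> lstep pc F R 1 j F R
  | LstepCheat r j : onth D pc = Some (DecJz r j) -> 0 < R r ->
      lstep pc F R 1 j true R.

(** The program counter stays exact here, although markings only show its truncation at [size D]. *)
Inductive lreach (free : bool) : seq nat -> nat -> bool -> (nat -> nat) -> Prop :=
  | Lreach0 : lreach free [::] 0 false R0
  | LreachS sigma pc F R a pc' F' R' :
      lreach free sigma pc F R -> lstep pc F R a pc' F' R' ->
      lreach free (rcons sigma a) pc' F' R'
  | LreachFree sigma pc R : free -> size D <= pc ->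
      lreach free sigma pc false R -> lreach free sigma pc true R.

Lemma state_le pc F : state pc F <= L.
Proof.
by rewrite /state /L -addn1 leq_add ?leq_b1 // leq_double geq_minr.
Qed.

(** The parity of a state is its flag. *)
Lemma state_inj pc F pc' F' :
  state pc F = state pc' F' -> minn pc H = minn pc' H /\ F = F'.
Proof.
move=> e; have eF : F = F'.
  by have := congr1 odd e; rewrite !oddD !odd_double; case: F F' {e} => -[].
split=> //; apply: double_inj; apply/eqP.
by rewrite -(eqn_add2r F) {2}eF; apply/eqP.
Qed.

Lemma machine_transP free t :
  t \in machine_trans free <->
  (free /\ t = (None, (state H false, state H true), (0, (0, 0)))) \/
  exists pc F i, onth D pc = Some i /\ t \in instr_trans pc F i.
Proof.
rewrite mem_cat; split=> [/orP[]|[[-> ->]|[pc [F [i [Di ti]]]]]].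
- by case: free => //; rewrite inE => /eqP ->; left.
- move=> /flattenP[s /allpairsP[[pc F] /= [pcH _ ->]] ti]; right.
  exists pc, F, (nth (Inc 0) D pc); split=> //.
  move: pcH; rewrite mem_iota add0n /= -onthTE -odflt_onth.
  by case: onth.
- by rewrite inE eqxx.
apply/orP; right; apply/flattenP; exists (instr_trans pc F i) => //.
apply/allpairsP; exists (pc, F); split=> /=.
- by rewrite mem_iota add0n /= -onthTE Di.
- by case: F {ti}.
by rewrite -odflt_onth Di.
Qed.

Lemma reg_lt pc i : onth D pc = Some i -> reg_of i < K.
Proof.
move=> Di; have pcD : pc < size D by rewrite -onthTE Di.
by have /all_nthP/(_ pc pcD) := regsK; move=> /(_ i); rewrite -odflt_onth Di.
Qed.

Lemma machine_trans_wf free t : t \in machine_trans free -> ct_wf K L t.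
Proof.
move=> /machine_transP[[_ ->]|[pc [F [i [/reg_lt iK]]]]].
  by apply/and3P; split; rewrite ?state_le.
by case: i iK => [r|r j] rK; rewrite !inE => tE; repeat case/orP: tE => tE;
  rewrite (eqP tE); apply/and3P; split; rewrite ?state_le.
Qed.

Lemma minn_eq_lt pc i : i < H -> minn pc H = minn i H -> pc = i.
Proof.
move=> iH; rewrite (minn_idPl (ltnW iH)); case: (leqP H pc) => // _ e.
by rewrite e ltnn in iH.
Qed.

(** An instruction transition starts below [H], where truncation is faithful, so [pc] is its
    address; the silent one only reveals [H <= pc]. *)
Lemma machine_transE free t pc F R :
  t \in machine_trans free -> state pc F = ct_src t ->
  ct_dec t <= R (ct_reg t) ->
  let R' := update R (ct_reg t) (R (ct_reg t) - ct_dec t + ct_inc t) in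
  (exists a pc' F',
    [/\ ct_label t = Some a, ct_dst t = state pc' F' & lstep pc F R a pc' F' R']) \/
  [/\ free, ct_label t = None, size D <= pc & F = false] /\
  (ct_dst t = state pc true /\ R' = R).
Proof.
move=> /machine_transP[[free_ ->]|[i [G [ins [Di]]]]].
  rewrite /ct_src /= => /state_inj[epc ->] _; right.
  have Hpc : H <= pc by move: epc; rewrite minnn => <-; apply: geq_minl.
  split=> //; split; first by rewrite /ct_dst /= /state epc.
  by rewrite /ct_reg /ct_dec /ct_inc /= subn0 addn0 update_id.
have iH : i < H by rewrite -onthTE Di.
case: ins Di => [r|r j] Di; rewrite !inE => tE; repeat case/orP: tE => tE;
  rewrite (eqP tE) /ct_src /ct_dec /ct_reg /ct_inc /ct_dst /ct_label /=;
  move=> /state_inj[/(minn_eq_lt iH) -> ->] le_dec; left.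
- exists 0, i.+1, G; split=> //.
  by rewrite subn0 addn1; apply: LstepInc.
- exists 0, i.+1, G; split=> //.
  case Rr: (R r) le_dec => [|n] // _; rewrite subSS subn0 addn0.
  exact: LstepDec Di Rr.
- exists 1, j, G; split=> //.
  by rewrite subn0 addn0 update_id; apply: LstepJump Di.
exists 1, j, true; split=> //.
by rewrite subnK // update_id; apply: LstepCheat Di _.
Qed.

Lemma lstep_trans free pc F R a pc' F' R' :
  lstep pc F R a pc' F' R' ->
  exists2 t, t \in machine_trans free &
    [/\ ct_label t = Some a, state pc F = ct_src t, ct_dec t <= R (ct_reg t),
        ct_dst t = state pc' F' &
        update R (ct_reg t) (R (ct_reg t) - ct_dec t + ct_inc t) = R'].
Proof.
case=> [r Di|r j n Di Rr|r j Di|r j Di Rr].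
- exists (Some 0, (state pc F, state pc.+1 F), (r, (0, 1))).
    by apply/machine_transP; right; exists pc, F, (Inc r); rewrite inE.
  by split=> //; rewrite /ct_reg /ct_dec /ct_inc /= subn0 addn1.
- exists (Some 0, (state pc F, state pc.+1 F), (r, (1, 0))).
    by apply/machine_transP; right; exists pc, F, (DecJz r j); rewrite !inE eqxx.
  by split; rewrite // /ct_reg /ct_dec /ct_inc /= Rr // subSS subn0 addn0.
- exists (Some 1, (state pc F, state j F), (r, (0, 0))).
    by apply/machine_transP; right; exists pc, F, (DecJz r j); rewrite !inE eqxx orbT.
  by split; rewrite // /ct_reg /ct_dec /ct_inc /= subn0 addn0 update_id.
exists (Some 1, (state pc F, state j true), (r, (1, 1))).
  by apply/machine_transP; right; exists pc, F, (DecJz r j); rewrite !inE eqxx !orbT.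
by split; rewrite // /ct_reg /ct_dec /ct_inc /= subnK // update_id.
Qed.

Lemma machine_fires free (k : 'I_(ntrans (machine_net free))) pc F R m' :
  let t := tnth (in_tuple (machine_trans free)) k in
  @fires (machine_net free) (machine_marking pc F R) k m' <->
  [/\ state pc F = ct_src t, ct_dec t <= R (ct_reg t) &
      m' = counter_marking K L (ct_dst t)
             (update R (ct_reg t) (R (ct_reg t) - ct_dec t + ct_inc t))].
Proof.
apply: counter_fires; last exact: state_le.
by apply: (@machine_trans_wf free); apply: mem_tnth.
Qed.

Lemma machine_fires_trans free t pc F R :
  t \in machine_trans free -> state pc F = ct_src t -> ct_dec t <= R (ct_reg t) ->
  exists2 k, label (machine_net free) k = ct_label t &
    @fires (machine_net free) (machine_marking pc F R) k
      (counter_marking K L (ct_dst t)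
        (update R (ct_reg t) (R (ct_reg t) - ct_dec t + ct_inc t))).
Proof.
move=> tin src dec.
have /tnthP[k ek] : t \in in_tuple (machine_trans free) by [].
by exists k; rewrite ?ffunE -?ek //; apply/machine_fires; rewrite -ek.
Qed.

Lemma machine_observable free sigma m' :
  @observable (machine_net free) (machine_marking 0 false R0) sigma m' <->
  exists pc F R, lreach free sigma pc F R /\ m' = machine_marking pc F R.
Proof.
split=> [[rho run <-]|[pc [F [R [reach ->]]]]].
  elim/last_ind: rho m' run => [|rho k IH] m' /=.
    by move=> ->; exists 0, false, R0; split=> //; apply: Lreach0.
  move=> /fires_seq_rcons[_ /IH[pc [F [R [reach ->]]]]].
  move=> /machine_fires[src dec ->].
  rewrite obs_label_rcons ffunE.
  have := machine_transE (mem_tnth k (in_tuple (machine_trans free))) src dec.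
  case=> [[a [pc' [F' [-> -> st]]]]|[[fr -> le_pc eF] [-> ->]]].
    exists pc', F'; eexists; split; last by [].
    exact: LreachS reach st.
  exists pc, true, R; split=> //.
  by apply: LreachFree; rewrite -?eF.
elim: reach => {sigma pc F R m'}
  [|sigma pc F R a pc' F' R' _ IH st|sigma pc R fr le_pc _ IH].
- by exists [::].
- have [t tin [tl src dec dst eR]] := lstep_trans free st.
  have [k kl fk] := machine_fires_trans tin src dec.
  by have := observable_fires IH fk; rewrite kl tl dst eR.
have tin : (None, (state H false, state H true), (0, (0, 0))) \in machine_trans free.
  by apply/machine_transP; left.
have eH : minn pc H = minn H H by rewrite (minn_idPr le_pc) minnn.
have src : state pc false = state H false by rewrite /state eH.
have [k kl fk] := machine_fires_trans tin src (leq0n (R 0)).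
have := observable_fires IH fk; rewrite kl /ct_dst /ct_reg /ct_dec /ct_inc /=.
by rewrite subn0 addn0 update_id /machine_marking /state eH.
Qed.

(** * Comparison of the two nets *)

Lemma lreach_free sigma pc F R : lreach false sigma pc F R -> lreach true sigma pc F R.
Proof.
elim=> {sigma pc F R} [|sigma pc F R a pc' F' R' _ IH st|//]; first exact: Lreach0.
exact: LreachS IH st.
Qed.

(* Dropping the free silent transition loses nothing: unless the run so far is the
   computation of the machine, the flag could have been raised at the first
   wrong zero test. *)
Lemma lreach_unfree sigma pc F R : ~ halts D (0, R0) ->
  lreach true sigma pc F R ->
  lreach false sigma pc F R /\
  (F = false -> reaches D (0, R0) (pc, R) \/ lreach false sigma pc true R).
Proof.
move=> nohalt; elim=> {sigma pc F R}.
- by split; [apply: Lreach0 | left; apply: reaches_refl].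
- move=> sigma pc F R a pc' F' R' _ [IH1 IH2] st; split; first exact: LreachS IH1 st.
  (* An honest step preserves either alternative: it prolongs the computation, or is copied with the
     flag up. *)
  have honest_or : F = false -> step D (pc, R) = (pc', R') ->
      lstep pc true R a pc' true R' ->
      reaches D (0, R0) (pc', R') \/ lreach false (rcons sigma a) pc' true R'.
    move=> /IH2[reach|reach] next st'; last by right; apply: LreachS reach st'.
    by left; apply: reaches_trans reach _; exists 1.
  case: st IH1 honest_or => [r Di|r j n Di Rr|r j Di|//] IH1 honest_or eF.
  - by apply: honest_or => //; [rewrite /= Di | apply: LstepInc].
  - by apply: honest_or => //; [rewrite /= Di Rr | apply: LstepDec Di Rr].
  case Rr: (R r) => [|n].
    by apply: honest_or => //; [rewrite /= Di Rr | apply: LstepJump Di].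
  (* A wrong zero test: the cheating transition has the same label and effect, but raises the
     flag. *)
  by right; apply: LreachS IH1 _; apply: LstepCheat Di _; rewrite Rr.
- move=> sigma pc R _ le_pc _ [_ /(_ erefl)[reach|//]].
  by case: nohalt; apply: reaches_halts reach le_pc.
Qed.

Lemma lreach_inv sigma pc F R : lreach false sigma pc F R ->
  [/\ sigma = [::], pc = 0, F = false & R = R0] \/
  exists sigma' a pc1 F1 R1, [/\ sigma = rcons sigma' a,
    lreach false sigma' pc1 F1 R1 & lstep pc1 F1 R1 a pc F R].
Proof.
case=> [|sigma' pc1 F1 R1 a pc' F' R' reach st|//]; first by left.
by right; exists sigma', a, pc1, F1, R1.
Qed.

Definition honest_label (c : config) : nat :=
  if onth D c.1 is Some (DecJz r _) then c.2 r == 0 else 0.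

Lemma lstep_honest c : c.1 < size D ->
  lstep c.1 false c.2 (honest_label c) (step D c).1 false (step D c).2.
Proof.
case: c => pc R; rewrite -onthTE /honest_label /=.
case Di: (onth D pc) => [[r|r j]|] // _; first exact: LstepInc.
by case Rr: (R r) => [|n]; [apply: LstepJump Di | apply: LstepDec Di Rr].
Qed.

(** Label 0 at a zero test forces the decrement; label 1 is honest only on a zero register, where
    cheating is disabled. *)
Lemma lstep_honest_uniq c pc F R : lstep c.1 false c.2 (honest_label c) pc F R ->
  (pc, F, R) = ((step D c).1, false, (step D c).2).
Proof.
case: c => pc0 S; move la: (honest_label _) => a st; move: la.
by case: st => [r|r j n|r j|r j] /= Di; rewrite /honest_label /= Di //;
  case: (S r) => [|m] // [->].
Qed.

(** The labels of the true computation determine the run without the silent transition, so its flag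
    stays down. *)
Lemma lreach_honest free k :
  let c := iter k (step D) (0, R0) in
  exists2 sigma, lreach free sigma c.1 false c.2 &
    forall pc F R, lreach false sigma pc F R -> (pc, F, R) = (c.1, false, c.2).
Proof.
elim: k => [|k /= [sigma reach uniq_reach]].
  exists [::]; first exact: Lreach0.
  by move=> pc F R /lreach_inv[[_ -> -> ->] //|[[|? ?] [? [? [? [? []]]]]]].
set c := iter k _ _ in reach uniq_reach *.
have [halted|running] := leqP (size D) c.1.
  by rewrite step_halted //; exists sigma.
exists (rcons sigma (honest_label c)).
  exact: LreachS reach (lstep_honest running).
move=> pc F R /lreach_inv[[]|]; first by case: (sigma).
move=> [sigma' [a [pc1 [F1 [R1 [/rcons_inj[<- <-] /uniq_reach[-> -> ->]]]]]]].
exact: lstep_honest_uniq.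
Qed.

(** All places are shared, so agreement is already equality. *)
Lemma machine_marking_equiv b1 b2 (m1 : marking (machine_net b1))
    (m2 : marking (machine_net b2)) :
  marking_equiv (Eq Zero Zero) m1 m2 <-> m1 = m2.
Proof.
split=> [[agr _]|->]; last by split.
apply/ffunP=> p; have := agr (val p).
by rewrite /tokens !valK in_fsetI /= (valP p); apply.
Qed.

Lemma machine_net_equiv :
  @net_equiv (Eq Zero Zero) (machine_net true) (machine_net false)
    (machine_marking 0 false R0) (machine_marking 0 false R0) <->
  ~ halts D (0, R0).
Proof.
split=> [[[_ abs] _] [k halted]|nohalt].
  (* On the honest labels, only the first net can end with the flag up. *)
  have [sigma reach uniq_reach] := lreach_honest true k.
  set c := iter k _ _ in halted reach uniq_reach.
  have /abs[_] : @observable (machine_net true) (machine_marking 0 false R0) sigma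
      (machine_marking c.1 true c.2).
    by apply/machine_observable; exists c.1, true, c.2; split=> //; apply: LreachFree.
  move=> /(_ _ ((machine_marking_equiv _ _).2 erefl)).
  move=> /machine_observable[pc [F [R [/uniq_reach[-> -> ->]]]]].
  by move=> /counter_marking_state /state_inj[].
have obsE sigma m' :
    @observable (machine_net true) (machine_marking 0 false R0) sigma m' <->
    @observable (machine_net false) (machine_marking 0 false R0) sigma m'.
  split=> /machine_observable[pc [F [R [reach ->]]]]; apply/machine_observable;
    exists pc, F, R; split=> //; last exact: lreach_free.
  by have [] := lreach_unfree nohalt reach.
split; split; try exact/machine_marking_equiv.
  move=> sigma m1 /obsE ob; split; first by exists m1; apply/machine_marking_equiv.
  by move=> m2 /machine_marking_equiv <-.
move=> sigma m1 ob; split; first by exists m1; apply/machine_marking_equiv.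
by move=> m2 /machine_marking_equiv <-; apply/obsE.
Qed.

End MachineNet.

(** * The diagonal argument *)

Lemma regs_bounded (D : program) : exists2 K, 1 < K & all (fun i => reg_of i < K) D.
Proof.
elim: D => [|i D [K K_gt1 IH]]; first by exists 2.
exists (maxn K (reg_of i).+1); first by rewrite leq_max K_gt1.
rewrite /= leq_maxr /=; apply: sub_all IH => j jK.
by rewrite leq_max jK.
Qed.

Theorem theorem1 :
  ~ exists M : program,
      forall (N1 N2 : net) (m1 : marking N1) (m2 : marking N2) (E : formula),
        {subset free_vars E <= (places N1 `|` places N2)%fset} ->
        let c := code_instance (Instance m1 m2 E) in
        (net_equiv E m1 m2 -> outputs M c 1) /\
        (~ net_equiv E m1 m2 -> outputs M c 0).
Proof.
case=> M decides.
have [K K_gt1 regsK] := regs_bounded (diagonal M).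
pose D := diagonal M; pose L := (size D).*2.+1.
(* [s] is the part of the instance independent of the initial marking. *)
pose s := [:: code_net (machine_net K D true); code_net (machine_net K D false);
              code_formula (Eq Zero Zero)].
(* [t] lists the entries of the initial marking after the two inputs: zero registers, then the two
   control places. *)
pose t := [seq place_value K L 0 (fun=> 0) p | p <- iota 2 K].
pose R0 := two_inputs (CodeSeq.code s) (CodeSeq.code t).
pose m : marking (machine_net K D true) := machine_marking K D 0 false R0.
have code_m : code_vector m =
    CodeSeq.code [:: CodeSeq.code s, CodeSeq.code t & t].
  rewrite /code_vector sort_counter_places; congr (CodeSeq.code _).
  rewrite /= !tokens_counter_marking // /place_value K_gt1 (ltnW K_gt1).
  congr [:: _, _ & _]; apply/eq_in_map => p; rewrite mem_iota add2n => /andP[p_ge2 pK].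
  rewrite tokens_counter_marking // /place_value /state min0n.
  by rewrite /R0 /two_inputs nth_default.
have equivE := machine_net_equiv R0 (ltnW K_gt1) regsK.
have [|yes no] := decides (machine_net K D true) (machine_net K D false) m m
  (Eq Zero Zero); first by [].
(* The instance code thus has the form [[:: v, v & s]] that the prelude of [D] computes. *)
have code_I : code_instance (@Instance (machine_net K D true)
    (machine_net K D false) m m (Eq Zero Zero)) =
  CodeSeq.code [:: code_vector m, code_vector m & s] by [].
rewrite code_I code_m in yes no.
(* If [D] halted, the answer would be 0 and [D] would loop. So it does not halt, the answer is 1,
   and [D] halts after all. *)
have nohalt : ~ halts D (0, R0).
  move=> halted; apply: diagonal_loops (halted); apply: no.
  by move=> /equivE.
by apply/nohalt/diagonal_halts/yes/equivE.
Qed.
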